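(* Let $\ell$ and $q$ be positive integers with $\ell^2\geq 2q^2+2$. Put $r=q+\ell$, $b=r^2-q^2-1$ and $d=2rq$. Then there exists a Type 2 triangle $T_2(2,b,d)$; that is, $b\geq 3$, $2\leq d\leq b-1$, and there is a Pythagorean triangle with one leg of length $d^2$ and the other leg of length $d_{2,b}=d(b+1)$.
   Context: A Pythagorean triangle is a right triangle all of whose side lengths are positive integers. For integers $b\geq 3$, $2\leq d\leq b-1$ and $k\geq 2$, $d_{k,b}=d\,(b^{k-1}+\cdots+b+1)=\dfrac{d(b^k-1)}{b-1}$ denotes the positive integer whose base $b$ representation consists of $k$ digits all equal to $d$. A Pythagorean triangle is a Type 2 triangle with base $b$ repeated digits, denoted $T_2(k,b,d)$ (with $b\geq 3$, $2\leq d\leq b-1$, $k\geq 2$), if one of its legs has length $d^k$ and the other leg has length $d_{k,b}$. *)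

(* Defs.v *)
From mathcomp Require Import all_boot.

Set Implicit Arguments.
Unset Strict Implicit.
Unset Printing Implicit Defensive.

(* A right triangle is represented by its side lengths: legs x and y,
   hypotenuse z. *)
Definition pythagorean_triangle (x y z : nat) : Prop :=
  [/\ 0 < x, 0 < y, 0 < z & x ^ 2 + y ^ 2 = z ^ 2].

(* The number d_{k,b} whose base b expansion consists of k digits d. *)
Definition repdigit (k b d : nat) : nat := d * \sum_(i < k) b ^ i.

Definition type2_triangle (k b d x y z : nat) : Prop :=
  [/\ 3 <= b, 2 <= d <= b - 1, 2 <= k, pythagorean_triangle x y z &
      (x = d ^ k /\ y = repdigit k b d) \/ (x = repdigit k b d /\ y = d ^ k)].

Lemma repdigit_closed k b d : (b - 1) * repdigit k b d = d * (b ^ k - 1).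
Proof. by rewrite /repdigit mulnCA !subn1 predn_exp. Qed.

Lemma repdigit2 b d : repdigit 2 b d = d * (b + 1).
Proof. by rewrite /repdigit big_ord_recr big_ord1 /= expn0 expn1 addnC. Qed.

(* Main.v *)
Require Import Defs.
From mathcomp Require Import all_boot.
From mathcomp Require Import zify ring.

(** Euclid's parametrization gives the right triangle with legs
    [r ^ 2 - q ^ 2] and [2 * r * q] and hypotenuse [r ^ 2 + q ^ 2].  The choice
    of [b] and [d] makes these legs [b + 1] and [d]; scaling by [d] turns them
    into [d * (b + 1)], the two-digit number [dd] in base [b], and [d ^ 2].
    What remains is that [d] is a legitimate digit: with [r = q + l] the
    inequality [d <= b - 1] reads
    [2 * q ^ 2 + 2 * q * l <= 2 * q * l + l ^ 2 - 2], which is exactly the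
    assumption on [l] and [q]. *)

(* Subtraction on nat is truncated, but here q < r, so q ^ 2 + 1 <= r ^ 2. *)
Theorem mainTheorem7 (l q r b d : nat)
  (hl : 0 < l) (hq : 0 < q) (hlq : 2 * q ^ 2 + 2 <= l ^ 2)
  (hr : r = q + l) (hb : b = r ^ 2 - q ^ 2 - 1) (hd : d = 2 * r * q) :
  exists x y z : nat, type2_triangle 2 b d x y z.
Proof.
have b1E : b + 1 = l ^ 2 + 2 * q * l by rewrite hb hr; nia.
have dE : d = 2 * q ^ 2 + 2 * q * l by rewrite hd hr; ring.
have q2_gt0 : 0 < q ^ 2 by rewrite expn_gt0 hq.
have ql_gt0 : 0 < q * l by rewrite muln_gt0 hq.
exists (d ^ 2), (d * (b + 1)), (d * (r ^ 2 + q ^ 2)).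
split=> //; [by lia | by lia | | by left; rewrite repdigit2].
have d_gt0 : 0 < d by lia.
split; rewrite ?expn_gt0 ?muln_gt0 ?addn_gt0 ?d_gt0 ?q2_gt0 ?orbT //=.
by rewrite b1E dE hr; ring.
Qed.
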